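(* Assume that (i) $\mathcal J:\mathcal X\to[0,+\infty]$ is proper, convex and weakly-* lower semicontinuous with weakly-* sequentially compact non-empty sublevel sets; (ii) $\mathcal H(\cdot\mid\cdot):\mathcal Y\times\mathcal Y\to[0,+\infty]$ is proper, convex in its first argument, weakly-* lower semicontinuous jointly in both arguments, and $\mathcal H(v\mid f)=0$ iff $v=f$; (iii) $A,A^l_n,A^u_n:\mathcal X\to\mathcal Y$ are weak-* to weak-* continuous; (iv) (source condition) there exists $\mu^\dagger\in\mathcal Y^*\times\mathcal Y^*$, $\mu^\dagger\ge0$, with $p^\dagger:=-B^*\mu^\dagger\in\partial\mathcal J(u^\dagger_{\mathcal J})$; and (v) $A^l_n\le A\le A^u_n$ for all $n$, $\|A^u_n-A^l_n\|\le\eta_n\to0$, $\mathcal H(\bar f\mid f_n)\le\delta_n\to0$ and $\alpha_n\to0$ as $n\to\infty$. Let $(u_n,v_n)$ be a solution of $$\min_{u\in\mathcal X,\ v\in\mathcal Y}\ \frac1{\alpha_n}\mathcal H(v\mid f_n)+\mathcal J(u)\quad\text{subject to}\quad A^l_nu\le v\le A^u_nu .$$ Then, with a constant $C$ independent of $n$, $$D^{p^\dagger}_{\mathcal J}(u_n,u^\dagger_{\mathcal J})\le\frac{\delta_n}{\alpha_n}+\frac1{\alpha_n}\Bigl[\mathcal H^*(\alpha_nE^*\mu^\dagger\mid f_n)-\langle\alpha_nE^*\mu^\dagger,\bar f\rangle\Bigr]+C\eta_n .$$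
   Context: $\mathcal X=\mathcal U^*$ and $\mathcal Y=\mathcal V^*$ are duals of Banach lattices with the dual norm and dual partial order ($y\ge0$ iff $\langle y,v\rangle\ge0$ for all $v\in\mathcal V$, $v\ge0$); orders on $\mathcal Y\times\mathcal Y$ and $\mathcal Y^*\times\mathcal Y^*$ are componentwise. $A:\mathcal X\to\mathcal Y$ is a bounded linear regular operator (difference of two positive operators), $A^l_n,A^u_n:\mathcal X\to\mathcal Y$ are bounded linear, and $A^l_n\le A\le A^u_n$ means $A^l_nu\le Au\le A^u_nu$ for all $u\ge0$. $\bar f\in\mathcal Y$ is the exact data, $f_n\in\mathcal Y$, $\alpha_n>0$. $u^\dagger_{\mathcal J}$ is a non-negative $\mathcal J$-minimising solution: $Au^\dagger_{\mathcal J}=\bar f$, $u^\dagger_{\mathcal J}\ge0$, $\mathcal J(u^\dagger_{\mathcal J})\le\mathcal J(u)$ whenever $Au=\bar f$. $B:\mathcal X\to\mathcal Y\times\mathcal Y$, $Bu=(Au,-Au)$; $E:\mathcal Y\to\mathcal Y\times\mathcal Y$, $Ev=(v,-v)$; $B^*,E^*$ are adjoints. $\mathcal H^*(\cdot\mid f)$ is the convex conjugate in the first argument. For $p\in\partial\mathcal J(w)$, the generalised Bregman distance is $D^p_{\mathcal J}(u,w)=\mathcal J(u)-\mathcal J(w)-\langle p,u-w\rangle$.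
   Formalization: The formal theorem additionally assumes that δ_n/α_n is bounded; with only δ_n→0 and α_n→0 the solutions u_n can be unbounded and no constant C independent of n need exist. *)

(* Defs.v *)
From HB Require Import structures.
From mathcomp Require Import all_boot all_order all_algebra.
From mathcomp Require Import all_classical all_reals all_analysis.

Set Implicit Arguments.
Unset Strict Implicit.
Unset Printing Implicit Defensive.

Import Order.TTheory GRing.Theory Num.Theory.
Import numFieldNormedType.Exports.

Local Open Scope classical_set_scope.
Local Open Scope ring_scope.

(* The order is not an instance of Order.Lattice: the library has no join of
   that structure with normed modules. Infima need no axiom, as the infimum of
   x and y is - lsup (- x) (- y). The modulus of x is lsup x (- x). *)
HB.mixin Record CompleteNormedModule_isBanachLattice (R : realType) T
    of CompleteNormedModule R T := {
  lle : T -> T -> Prop ;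
  lsup : T -> T -> T ;
  lle_refl : forall x, lle x x ;
  lle_anti : forall x y, lle x y -> lle y x -> x = y ;
  lle_trans : forall y x z, lle x y -> lle y z -> lle x z ;
  lle_supl : forall x y, lle x (lsup x y) ;
  lle_supr : forall x y, lle y (lsup x y) ;
  lsup_le : forall x y z, lle x z -> lle y z -> lle (lsup x y) z ;
  lle_addr : forall z x y, lle x y -> lle (x + z) (y + z) ;
  lle_scale : forall (a : R) x, 0 <= a -> lle 0 x -> lle 0 (a *: x) ;
  lle_norm : forall x y, lle (lsup x (- x)) (lsup y (- y)) -> `|x| <= `|y|
}.

#[short(type="banachLatticeType")]
HB.structure Definition BanachLattice (R : realType) :=
  { T of CompleteNormedModule R T
       & CompleteNormedModule_isBanachLattice R T }.

Section BoundedLinear.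
Context {R : realType} (E F : normedModType R).

Definition bounded_linear : {pred E -> F} :=
  fun f => `[< linear f /\ continuous f >].

Fact bounded_linear_submod_closed : submod_closed bounded_linear.
Proof.
split.
  apply/asboolP; split=> [a x y|x]; first by rewrite /= scaler0 addr0.
  exact: cvg_cst.
move=> a f g /asboolP[lf cf] /asboolP[lg cg]; apply/asboolP; split.
  move=> b x y; rewrite !fctE lf lg !scalerDr !scalerA [b * a]mulrC.
  by rewrite addrACA.
move=> x; apply: cvgD; last exact: cg.
by apply: cvgZr; exact: cf.
Qed.

HB.instance Definition _ :=
  GRing.isSubmodClosed.Build R (E -> F) bounded_linear
    bounded_linear_submod_closed.

Record blin := BLin { blin_fun :> E -> F ; _ : blin_fun \in bounded_linear }.

HB.instance Definition _ := [isSub for blin_fun].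
HB.instance Definition _ := [Choice of blin by <:].
HB.instance Definition _ := [SubChoice_isSubLmodule of blin by <:].

Lemma blin_linear (f : blin) : linear f.
Proof. by case: f => f /= /asboolP[]. Qed.

Lemma blin_continuous (f : blin) : continuous f.
Proof. by case: f => f /= /asboolP[]. Qed.

HB.instance Definition _ (f : blin) :=
  GRing.isLinear.Build R E F *:%R (blin_fun f) (blin_linear f).

Definition opnorm (f : blin) : R := sup [set `|f x| | x in [set x | `|x| <= 1]].

Lemma opnorm_has_sup (f : blin) :
  has_sup [set `|f x| | x in [set x | `|x| <= 1]].
Proof.
split; first by exists `|f 0|; exists 0 => //=; rewrite normr0.
have : bounded_near f (nbhs (0 : E)).
  by apply/linear_bounded_continuous; exact: blin_continuous.
move=> /bounded_funP/(_ 1)[M fM].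
by exists M => _ [x /= x1 <-]; exact: fM.
Qed.

Lemma opnorm_ub (f : blin) x : `|x| <= 1 -> `|f x| <= opnorm f.
Proof.
by move=> x1; apply: sup_upper_bound; [exact: opnorm_has_sup|exists x].
Qed.

Lemma opnorm_le (f : blin) c :
  (forall x, `|x| <= 1 -> `|f x| <= c) -> opnorm f <= c.
Proof.
move=> fc; apply: ge_sup; first by case: (opnorm_has_sup f).
by move=> _ [x /= x1 <-]; exact: fc.
Qed.

Lemma opnorm_ge0 (f : blin) : 0 <= opnorm f.
Proof. by apply: le_trans (@opnorm_ub f 0 _); rewrite ?normr0. Qed.

Fact opnormD (f g : blin) : opnorm (f + g) <= opnorm f + opnorm g.
Proof.
apply: opnorm_le => x x1.
by rewrite (le_trans (ler_normD _ _))// lerD// opnorm_ub.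
Qed.

Fact opnormZ (a : R) (f : blin) : opnorm (a *: f) = `|a| * opnorm f.
Proof.
have le b (g : blin) : opnorm (b *: g) <= `|b| * opnorm g.
  apply: opnorm_le => x x1.
  by rewrite [leLHS]normrZ ler_wpM2l// opnorm_ub.
apply/eqP; rewrite eq_le le/=.
have [->|a0] := eqVneq a 0; first by rewrite normr0 mul0r opnorm_ge0.
have := le a^-1 (a *: f).
by rewrite scalerA mulVf// scale1r normfV ler_pdivlMl// normr_gt0.
Qed.

Fact opnorm_eq0 (f : blin) : opnorm f = 0 -> f = 0.
Proof.
move=> f0; apply/val_inj/funext => x /=.
have [->|x0] := eqVneq x 0; first by rewrite linear0.
have : `|f (`|x|^-1 *: x)| <= 0.
  rewrite -f0; apply: opnorm_ub.
  by rewrite normrZ normfV normr_id mulVf// normr_eq0.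
rewrite linearZ normrZ normfV normr_id pmulr_rle0 ?invr_gt0 ?normr_gt0//.
by rewrite normr_le0 => /eqP.
Qed.

HB.instance Definition _ :=
  Lmodule_isNormed.Build R blin opnormD opnormZ opnorm_eq0.

End BoundedLinear.
Arguments bounded_linear {R} E F.

Notation dual E := (blin E (GRing.regular _)).

Section Operators.
Context {R : realType}.
Implicit Types E F G : normedModType R.

Fact adjoint_subproof E F (T : blin E F) (q : dual F) :
  (q \o T : E -> R^o) \in bounded_linear E R^o.
Proof.
apply/asboolP; split=> [a x y|x]; first by rewrite /= !linearP.
by apply: continuous_comp; exact: blin_continuous.
Qed.

Definition adjoint E F (T : blin E F) (q : dual F) : dual E :=
  BLin (adjoint_subproof T q).

Fact dual_pair_subproof E F (q : dual E * dual F) :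
  (fun z => q.1 z.1 + q.2 z.2 : R^o) \in bounded_linear (E * F)%type R^o.
Proof.
apply/asboolP; split=> [a x y|x].
  by rewrite /= !linearP scalerDr addrACA.
apply: cvgD.
- by apply: (@continuous_comp _ _ _ fst q.1); [exact: cvg_fst|exact: blin_continuous].
- by apply: (@continuous_comp _ _ _ snd q.2); [exact: cvg_snd|exact: blin_continuous].
Qed.

(* The identification of E^* x F^* with the dual of E x F. *)
Definition dual_pair E F (q : dual E * dual F) : dual (E * F)%type :=
  BLin (dual_pair_subproof q).

Fact opB_subproof E F (A : blin E F) :
  (fun u => (A u, - A u)) \in bounded_linear E (F * F)%type.
Proof.
apply/asboolP; split=> [a x y|x].
  by apply/pair_equal_spec; split; rewrite /= linearP// opprD scalerN.
apply: cvg_pair; first exact: blin_continuous.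
by apply: cvgN; exact: blin_continuous.
Qed.

Definition opB E F (A : blin E F) : blin E (F * F)%type :=
  BLin (opB_subproof A).

Fact opE_subproof F : (fun v : F => (v, - v)) \in bounded_linear F (F * F)%type.
Proof.
apply/asboolP; split=> [a x y|x].
  by apply/pair_equal_spec; split; rewrite //= opprD scalerN.
by apply: cvg_pair; [exact: cvg_id|apply: cvgN; exact: cvg_id].
Qed.

Definition opE F : blin F (F * F)%type := BLin (opE_subproof F).

End Operators.

Section Order.
Context {R : realType}.

Definition pos_cone (U : banachLatticeType R) : set U :=
  [set x | lle 0 x].
Arguments pos_cone : clear implicits.

Definition dual_cone {E : normedModType R} (K : set E) : set (dual E) :=
  [set y : dual E | forall x, K x -> 0 <= (y x : R)].

(* The orders on the dual and on the bidual of a Banach lattice. *)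
Definition dual_ge0 (U : banachLatticeType R) : set (dual U) :=
  dual_cone (pos_cone U).

Definition bidual_ge0 (U : banachLatticeType R) : set (dual (dual U)) :=
  dual_cone (@dual_ge0 U).

Definition dual_le {U : banachLatticeType R} (x y : dual U) : Prop :=
  dual_ge0 (y - x).

Context {U : banachLatticeType R} {V : banachLatticeType R}.

Definition op_le (S T : dual U -> dual V) : Prop :=
  forall u, dual_ge0 u -> dual_le (S u) (T u).

Definition positive_op (T : dual U -> dual V) : Prop :=
  forall u, dual_ge0 u -> dual_ge0 (T u).

Definition regular_op (A : blin (dual U) (dual V)) : Prop :=
  exists P Q : {linear dual U -> dual V},
    [/\ positive_op P, positive_op Q & forall u, A u = P u - Q u].

End Order.

(* The topology of pointwise convergence on E. *)
Definition weakstar {R : realType} (E : normedModType R) : topologicalType :=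
  initial_topology (fun y : dual E => (y : {ptws E -> R^o})).

Definition seq_compact {T : topologicalType} (K : set T) : Prop :=
  forall x : nat -> T, (forall n, K (x n)) ->
  exists2 l, K l & exists2 phi : nat -> nat,
    {homo phi : m n / (m < n)%N} & x (phi n) @[n --> \oo] --> l.

Section ConvexAnalysis.
Local Open Scope ereal_scope.
Context {R : realType} {E : normedModType R}.

Definition ereal_proper {T : Type} (g : T -> \bar R) : Prop :=
  (forall x, g x != -oo) /\ exists x, g x < +oo.

Definition ereal_convex (g : E -> \bar R) : Prop :=
  forall (x y : E) (t : R), (0 <= t <= 1)%R ->
    g (t *: x + (1 - t) *: y)%R <= t%:E * g x + (1 - t)%R%:E * g y.

Definition subdifferential (g : E -> \bar R) (w : E) : set (dual E) :=
  [set p : dual E | forall u, g w + (p (u - w)%R)%:E <= g u].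

Definition bregman (g : E -> \bar R) (p : dual E) (u w : E) : \bar R :=
  g u - g w - (p (u - w)%R)%:E.

Definition convex_conjugate (g : E -> \bar R) (q : dual E) : \bar R :=
  ereal_sup (range (fun v => (q v)%:E - g v)).

End ConvexAnalysis.

Section Problem.
Local Open Scope ereal_scope.
Context {R : realType}.
Context {U : banachLatticeType R} {V : banachLatticeType R}.

Definition J_minimising_solution (J : dual U -> \bar R)
    (A : blin (dual U) (dual V)) (fbar : dual V) (udag : dual U) : Prop :=
  [/\ A udag = fbar, dual_ge0 udag
    & forall u, A u = fbar -> J udag <= J u].

Definition feasible (Al Au : blin (dual U) (dual V))
    (u : dual U) (v : dual V) : Prop :=
  dual_le (Al u) v /\ dual_le v (Au u).

Definition objective (J : dual U -> \bar R)
    (H : dual V -> dual V -> \bar R) (alpha : R) (f : dual V)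
    (u : dual U) (v : dual V) : \bar R :=
  (alpha^-1)%:E * H v f + J u.

Definition problem_solution (J : dual U -> \bar R)
    (H : dual V -> dual V -> \bar R) (Al Au : blin (dual U) (dual V))
    (alpha : R) (f : dual V) (u : dual U) (v : dual V) : Prop :=
  feasible Al Au u v /\
  forall u' v', feasible Al Au u' v' ->
    objective J H alpha f u v <= objective J H alpha f u' v'.

End Problem.

(* Main.v *)
Require Import Defs.
From HB Require Import structures.
From mathcomp Require Import all_boot all_order all_algebra.
From mathcomp Require Import all_classical all_reals all_analysis.
From mathcomp Require Import lra.

Set Implicit Arguments.
Unset Strict Implicit.
Unset Printing Implicit Defensive.

Import Order.TTheory GRing.Theory Num.Theory.
Import numFieldNormedType.Exports.

Local Open Scope classical_set_scope.
Local Open Scope ring_scope.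

(** The pair (udag, fbar) is feasible for every n, because udag is non-negative
    and A lies between Al n and Au n. Comparing the minimal value with the value
    at this pair gives H (v n) (f n) / alpha n + J (u n) <= delta n / alpha n +
    J udag. Put this bound on J (u n) into the Bregman distance. By the source
    condition its linear part is the pairing of m := E^* mudag with
    A (u n) - fbar, and
      m (A (u n) - fbar) = m (v n - fbar) + m (A (u n) - v n).
    The first summand and - H (v n) (f n) / alpha n are absorbed by the convex
    conjugate at alpha n *: m, by the Fenchel--Young inequality
    (bregman_energy_le).

    It remains to bound m (A (u n) - v n) by a multiple of eta n. The iterate
    u n may have either sign, so A (u n) need not lie between Al n (u n) and
    Au n (u n). However, if w >= 0 and w >= u n, then the bounds on A apply to w and
    to w - u n, and they give
      - (Au n - Al n) w <= A (u n) - v n <= (Au n - Al n) w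
    (feasible_residual_le). The positive part of u n in the dual lattice is such
    a w, and its norm is at most that of u n. It is built by the
    Riesz--Kantorovich formula (dual_pos_majorant). As the components of mudag
    are non-negative, the pairing is at most
    (`|mudag.1| + `|mudag.2|) * `|u n| * eta n.

    Finally `|u n| is bounded uniformly in n. All u n lie in one sublevel set of
    J, since delta n / alpha n is bounded, and a weakly-* sequentially compact
    set is norm bounded, by the uniform boundedness principle
    (weakstar_seq_compact_bounded). *)

(** * Bounded operators *)

Section OperatorNorm.
Context {R : realType}.

Lemma blin_norm_le (E F : normedModType R) (T : blin E F) (x : E) :
  `|T x| <= `|T| * `|x|.
Proof.
have [->|x0] := eqVneq x 0; first by rewrite linear0 !normr0 mulr0.
have x_gt0 : 0 < `|x| by rewrite normr_gt0.
have : `|T (`|x|^-1 *: x)| <= `|T|.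
  by apply: opnorm_ub; rewrite normrZ normfV normr_id mulVf// normr_eq0.
by rewrite linearZ normrZ normfV normr_id ler_pdivrMl// mulrC.
Qed.

Lemma blin_subl (E F : normedModType R) (S T : blin E F) (x : E) :
  (S - T) x = S x - T x.
Proof. by []. Qed.

Lemma blin_subr (E F : normedModType R) (T : blin E F) (x y : E) :
  T (x - y) = T x - T y.
Proof. exact: linearB. Qed.

Lemma dual_subl (E : normedModType R) (y z : dual E) (x : E) :
  (y - z) x = (y x : R) - z x :> R.
Proof. by []. Qed.

Lemma linear_bounded_mem (E F : normedModType R) (w : E -> F) (c : R) :
  linear w -> (forall x, `|w x| <= c * `|x|) -> w \in bounded_linear E F.
Proof.
move=> lw wc; apply/asboolP; split=> //.
pose W : {linear E -> F} := HB.pack w (GRing.isLinear.Build _ _ _ _ _ lw).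
apply: (linear_bounded_continuous W).1; apply/bounded_funP => r.
exists (`|c| * r) => x xr; apply: le_trans (wc x) _.
by rewrite (le_trans (ler_wpM2r _ (ler_norm c)))// ler_wpM2l.
Qed.

End OperatorNorm.

(** * Positive parts in a Banach lattice *)

Section BanachLattice.
Context {R : realType} {U : banachLatticeType R}.
Implicit Types x y z : U.

Lemma lle_subE x y : lle x y <-> lle 0 (y - x).
Proof.
split=> [/(lle_addr (- x))|/(lle_addr x)]; first by rewrite subrr.
by rewrite add0r subrK.
Qed.

Lemma lle_add x y x' y' : lle x y -> lle x' y' -> lle (x + x') (y + y').
Proof.
move=> /(lle_addr x') xy /(lle_addr y) x'y'.
by apply: lle_trans xy _; rewrite [y + x']addrC [y + y']addrC.
Qed.

Lemma lle_add_ge0 x y : lle 0 x -> lle 0 y -> lle 0 (x + y).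
Proof. by move=> x0 y0; rewrite -[0]addr0; exact: lle_add. Qed.

Definition lpos x := lsup x 0.

Lemma lpos_ge0 x : lle 0 (lpos x). Proof. exact: lle_supr. Qed.

Lemma lpos_ge x : lle x (lpos x). Proof. exact: lle_supl. Qed.

(** Translation by - x maps the pair x, 0 to the pair 0, - x and commutes with
    suprema. Of the two inequalities this asserts, one at - x gives the other
    at x, so a single half (le below) is enough. *)
Lemma lpos_sub x : lpos x - lpos (- x) = x.
Proof.
suff le z : lle (lpos (- z)) (lpos z - z).
  apply/eqP; rewrite subr_eq; apply/eqP/lle_anti.
    by have := le (- x); rewrite !opprK addrC.
  by have /(lle_addr x) := le x; rewrite subrK addrC.
apply: lsup_le; last exact: (lle_subE _ _).1 (lpos_ge z).
by have /(lle_addr (- z)) := lpos_ge0 z; rewrite add0r.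
Qed.

(** Twice the modulus dominates x + (- x) = 0. *)
Lemma lmod_ge0 x : lle 0 (lsup x (- x)).
Proof.
have : lle (x - x) (lsup x (- x) + lsup x (- x)).
  by apply: lle_add; [exact: lle_supl|exact: lle_supr].
rewrite subrr -mulr2n -scaler_nat => /(@lle_scale _ U 2^-1).
by rewrite scalerA mulVf// scale1r; apply; rewrite invr_ge0.
Qed.

Lemma lle_norm_ge0 x y : lle 0 y -> lle y (lsup x (- x)) -> `|y| <= `|x|.
Proof.
move=> y0 yx; apply: lle_norm; apply: lsup_le => //.
apply: lle_trans (lmod_ge0 x).
by have /(lle_addr (- y)) := y0; rewrite add0r subrr.
Qed.

Lemma lpos_norm x : `|lpos x| <= `|x|.
Proof.
apply: lle_norm_ge0; first exact: lpos_ge0.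
by apply: lsup_le; [exact: lle_supl|exact: lmod_ge0].
Qed.

Lemma lle_norm_mono x y : lle 0 y -> lle y x -> `|y| <= `|x|.
Proof.
move=> y0 yx; apply: lle_norm_ge0 => //.
exact: lle_trans yx (lle_supl _ _).
Qed.

End BanachLattice.

(** * Positive parts in the dual lattice *)

Section RieszKantorovich.
Context {R : realType} {U : banachLatticeType R}.

(** The extension takes the value g a - g b at a - b, for a and b in the cone;
    additivity of g makes this independent of the decomposition (wE below), and
    linearity follows. Both g (lpos x) and g (lpos (- x)) lie between 0 and
    c * `|x|, so their difference does not exceed c * `|x| in absolute value:
    the norm bound c is kept, with no factor 2. *)
Lemma cone_functional_extends (g : U -> R) (c : R) : 0 <= c ->
  (forall x y, lle 0 x -> lle 0 y -> g (x + y) = g x + g y) ->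
  (forall a x, 0 <= a -> lle 0 x -> g (a *: x) = a * g x) ->
  (forall x, lle 0 x -> 0 <= g x <= c * `|x|) ->
  exists2 w : dual U, (forall x, lle 0 x -> w x = g x) & `|w| <= c.
Proof.
move=> c0 gD gZ gb.
have g0 : g 0 = 0 by rewrite -(scale0r (0 : U)) gZ ?mul0r//; exact: lle_refl.
pose w (x : U) : R^o := g (lpos x) - g (lpos (- x)).
have wE a b : lle 0 a -> lle 0 b -> w (a - b) = g a - g b.
  move=> a0 b0.
  suff : g (lpos (a - b)) + g b = g a + g (lpos (- (a - b))).
    by move=> gab; apply/eqP; rewrite subr_eq addrAC -gab addrK.
  rewrite -!gD//; try exact: lpos_ge0.
  by congr g; apply/eqP; rewrite -subr_eq addrAC lpos_sub subrK.
have lw : linear w.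
  have wD x y : w (x + y) = w x + w y.
    rewrite -{1}(lpos_sub x) -{1}(lpos_sub y) addrACA -opprD.
    rewrite wE ?gD//;
      try by [exact: lpos_ge0|apply: lle_add_ge0; exact: lpos_ge0].
    by rewrite opprD addrACA.
  have wN x : w (- x) = - w x by rewrite /w opprK opprB.
  have wZ a x : 0 <= a -> w (a *: x) = a * w x.
    move=> a0; rewrite -{1}(lpos_sub x) scalerBr.
    rewrite wE; try by apply: lle_scale => //; exact: lpos_ge0.
    by rewrite !gZ ?mulrBr//; exact: lpos_ge0.
  move=> a x y; rewrite wD; congr (_ + _).
  have [a0|a0] := leP 0 a; first exact: wZ.
  rewrite -[a]opprK scaleNr wN wZ ?oppr_ge0 ?ltW//.
  by rewrite [RHS]scaleNr.
have g_le x : 0 <= g (lpos x) <= c * `|x|.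
  have /andP[-> gx] := gb _ (lpos_ge0 x).
  by apply: le_trans gx _; rewrite ler_wpM2l// lpos_norm.
have wc x : `|w x| <= c * `|x|.
  have /andP[p0 pc] := g_le x; have /andP[n0 nc] := g_le (- x).
  rewrite normrN in nc; rewrite /w ler_norml lerBrDl lerBlDr.
  by apply/andP; split; lra.
have w_mem := linear_bounded_mem lw wc.
exists (BLin w_mem) => [x x0|].
  by rewrite /= -{1}(subr0 x) wE ?g0 ?subr0//; exact: lle_refl.
apply: opnorm_le => x x1 /=.
by rewrite (le_trans (wc x))// ler_piMr.
Qed.

(** The witness is the positive part of u, whose value at x >= 0 is the supremum
    of u over the order interval from 0 to x (Riesz--Kantorovich). Additivity in
    x is the Riesz decomposition property. *)
Lemma dual_pos_majorant (u : dual U) : exists w : dual U,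
  [/\ dual_ge0 w, dual_le u w & `|w| <= `|u|].
Proof.
pose S x : set R := [set (u y : R) | y in [set y | lle 0 y /\ lle y x]].
have S_ub x : ubound (S x) (`|u| * `|x|).
  move=> _ [y [y0 yx] <-]; apply: le_trans (ler_norm _) _.
  by rewrite (le_trans (blin_norm_le _ _))// ler_wpM2l// lle_norm_mono.
have S0 x : lle 0 x -> S x 0.
  by move=> x0; exists 0; [split=> //; exact: lle_refl|rewrite linear0].
have S_sup x : lle 0 x -> has_sup (S x).
  by move=> x0; split; [exists 0; exact: S0|exists (`|u| * `|x|)].
pose g x := sup (S x).
have g_ub x y : lle 0 y -> lle y x -> (u y : R) <= g x.
  move=> y0 yx; apply: sup_upper_bound; last by exists y.
  exact/S_sup/lle_trans/yx.
have g_le x c : lle 0 x ->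
    (forall y, lle 0 y -> lle y x -> (u y : R) <= c) -> g x <= c.
  move=> x0 uc; apply: ge_sup; first by exists 0; exact: S0.
  by move=> _ [y [y0 yx] <-]; exact: uc.
have gD x y : lle 0 x -> lle 0 y -> g (x + y) = g x + g y.
  move=> x0 y0; have xy0 := lle_add_ge0 x0 y0.
  apply/eqP; rewrite eq_le; apply/andP; split.
    apply: (g_le) => // z z0 zxy.
    (* Split z = (z - z2) + z2 with 0 <= z - z2 <= x and 0 <= z2 <= y. *)
    pose z2 := lpos (z - x).
    have z2y : lle z2 y.
      apply: lsup_le => //; have := lle_addr (- x) _ _ zxy.
      by rewrite addrAC subrr add0r.
    have z2z : lle z2 z.
      apply: lsup_le => //; apply/(lle_subE _ _).2.
      by rewrite opprB addrC subrK.
    have z1x : lle (z - z2) x.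
      have := lle_addr (x - z2) _ _ (lpos_ge (z - x)).
      by rewrite addrA subrK [z2 + _]addrC subrK.
    rewrite -[z](subrK z2) linearD lerD//; apply: g_ub => //.
      exact: (lle_subE _ _).1 z2z.
    exact: lpos_ge0.
  rewrite -lerBrDr; apply: (g_le) => // a a0 ax; rewrite lerBrDl -lerBrDr.
  apply: (g_le) => // b b0 yb; rewrite lerBrDl -linearD.
  by apply: g_ub; [exact: lle_add_ge0|exact: lle_add].
have gZ a x : 0 <= a -> lle 0 x -> g (a *: x) = a * g x.
  (* Taken with b = a^-1 at a *: x, this also gives the reverse inequality. *)
  have le b y : 0 < b -> lle 0 y -> g (b *: y) <= b * g y.
    move=> b0 y0; apply: g_le; first exact: (lle_scale _ _ (ltW b0) y0).
    move=> z z0 zby; have bV0 : 0 <= b^-1 by rewrite invr_ge0 ltW.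
    rewrite -ler_pdivrMl//.
    have -> : b^-1 * (u z : R) = u (b^-1 *: z) by rewrite linearZ.
    apply: g_ub; first exact: lle_scale.
    apply/(lle_subE _ _).2.
    rewrite -{1}(scale1r y) -(mulVf (lt0r_neq0 b0)) -scalerA -scalerBr.
    apply: lle_scale => //; exact: (lle_subE _ _).1 zby.
  rewrite le_eqVlt => /predU1P[<- _|a0 x0].
    rewrite scale0r mul0r; apply: (@addrI _ (g 0)).
    by rewrite -gD ?addr0//; exact: lle_refl.
  apply/eqP; rewrite eq_le le//=.
  have := le a^-1 (a *: x); rewrite invr_gt0 scalerA mulVf ?lt0r_neq0// scale1r.
  by rewrite ler_pdivlMl//; apply => //; exact: (lle_scale _ _ (ltW a0) x0).
have gb x : lle 0 x -> 0 <= g x <= `|u| * `|x|.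
  move=> x0; apply/andP; split.
    by rewrite -(linear0 u) g_ub//; exact: lle_refl.
  by apply: ge_sup; [exists 0; exact: S0|exact: S_ub].
have [w wg wu] := cone_functional_extends (normr_ge0 u) gD gZ gb.
exists w; split=> // x x0; first by rewrite wg//; have /andP[] := gb _ x0.
by rewrite /= subr_ge0 wg//; apply: g_ub => //; exact: lle_refl.
Qed.

End RieszKantorovich.

(** * Norm boundedness of weakly-* sequentially compact sets *)

Section WeakStarCompact.
Context {R : realType}.

Lemma weakstar_cvg (E : normedModType R) (x : nat -> dual E) (l : dual E)
    (y : E) :
  (x n : weakstar E) @[n --> \oo] --> (l : weakstar E) ->
  (x n y : R^o) @[n --> \oo] --> (l y : R^o).
Proof.
move=> xl.
have xl' : {ptws, (fun n => (x n : {ptws E -> R^o})) @ \oo --> (l : E -> R^o)}.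
  apply: (@cvg_comp _ _ _ (fun n => x n : weakstar E)
    (fun z : dual E => (z : {ptws E -> R^o}))); first exact: xl.
  exact: initial_continuous.
exact: (pointwise_cvgP _ _).1 xl' y.
Qed.

(** By the uniform boundedness principle it suffices to bound the values at each
    point x. If they were unbounded, some sequence in K would satisfy
    `|y n x| > n, and so would not have a subsequence that converges at x. *)
Lemma weakstar_seq_compact_bounded (E : completeNormedModType R)
    (K : set (weakstar E)) :
  seq_compact K -> exists M : R, forall y : dual E, K y -> `|y| <= M.
Proof.
move=> cK.
pose F : set (E -> R^o) := [set (y : E -> R^o) | y in (K : set (dual E))].
have ptF : pointwise_bounded F.
  move=> x; apply: contrapT => /forallNP nb.
  have /choice[y yP] (n : nat) : exists y : dual E, K y /\ n%:R < `|y x : R^o|.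
    have /existsNP[_ /not_implyP[[y Ky <-]] /negP] := nb n%:R.
    by rewrite -ltNge; exists y.
  have [l _ [phi phi_lt yl]] := cK y (fun n => (yP n).1).
  have /cvg_seq_bounded [M [_ /(_ (M + 1))]] :=
    cvgP _ (@weakstar_cvg E (y \o phi) l x yl).
  rewrite ltrDl ltr01 => /(_ isT) yM.
  have [n Mn] : exists n : nat, M + 1 < n%:R.
    by exists (Num.truncn (M + 1)).+1; exact: truncnS_gt.
  have := yM n I; apply/negP; rewrite -ltNge.
  apply: lt_trans Mn _; apply: le_lt_trans (yP (phi n)).2.
  rewrite ler_nat.
  by elim: n => [|k IH]; [|exact: leq_ltn_trans IH (phi_lt _ _ (ltnSn k))].
have [] := @Banach_Steinhauss R E R^o F _ ptF 1.
  move=> _ [y _ <-]; split; last exact: blin_linear.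
  by move=> r; exists (`|y| * r) => x xr;
    apply: le_trans (blin_norm_le _ _) _; rewrite ler_wpM2l.
move=> M FM; exists M => y Ky; apply: opnorm_le => x x1.
by apply: FM x1; exists y.
Qed.

End WeakStarCompact.

(** * The data residual of a feasible pair *)

Section Residual.
Context {R : realType} {U V : banachLatticeType R}.
Implicit Types (A Al Au : blin (dual U) (dual V)) (u : dual U) (v : dual V).

(** With d := w - u both w and d are non-negative. Write A u = A w - A d and use
    A w <= Au w, A d >= Al d and Al u = Al w - Al d <= v: this gives
    A u - v <= (Au - Al) w. The bound on v - A u is symmetric. *)
Lemma feasible_residual_le A Al Au u v :
  op_le Al A -> op_le A Au -> feasible Al Au u v ->
  exists w : dual U, [/\ `|w| <= `|u|,
    dual_le (A u - v) ((Au - Al) w) & dual_le (v - A u) ((Au - Al) w)].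
Proof.
move=> AlA AAu [Alv vAu]; have [w [w0 uw wu]] := dual_pos_majorant u.
exists w; split=> // x x0.
- have := Alv x x0; have := AlA _ uw x x0; have := AAu _ w0 x x0.
  by rewrite blin_subl !blin_subr !dual_subl; lra.
- have := vAu x x0; have := AAu _ uw x x0; have := AlA _ w0 x x0.
  by rewrite blin_subl !blin_subr !dual_subl; lra.
Qed.

Lemma bidual_mono (mu : dual (dual V)) (y z : dual V) :
  bidual_ge0 mu -> dual_le y z -> (mu y : R) <= mu z.
Proof. by move=> mu0 yz; rewrite -subr_ge0 -[_ - _](linearB mu) mu0. Qed.

Lemma residual_pairing_le A Al Au u v (mu : dual (dual V) * dual (dual V)) :
  op_le Al A -> op_le A Au -> feasible Al Au u v ->
  bidual_ge0 mu.1 -> bidual_ge0 mu.2 ->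
  mu.1 (A u - v) + mu.2 (v - A u) <=
    (`|mu.1| + `|mu.2|) * `|u| * `|Au - Al| :> R.
Proof.
move=> AlA AAu uv mu1 mu2.
have [w [wu w1 w2]] := feasible_residual_le AlA AAu uv.
have le (m : dual (dual V)) : (m ((Au - Al) w) : R) <= `|m| * `|u| * `|Au - Al|.
  apply: le_trans (ler_norm _) _; apply: le_trans (blin_norm_le _ _) _.
  rewrite -mulrA ler_wpM2l//; apply: le_trans (blin_norm_le _ _) _.
  by rewrite mulrC ler_wpM2r.
rewrite !mulrDl lerD//; (apply: le_trans (le _); exact: bidual_mono).
Qed.

End Residual.

(** * The estimate for a single problem *)

Section Estimate.
Local Open Scope ereal_scope.
Context {R : realType} {U V : banachLatticeType R}.
Implicit Types (J : dual U -> \bar R) (H : dual V -> dual V -> \bar R).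
Implicit Types (A Al Au : blin (dual U) (dual V)) (alpha delta : R).
Implicit Types (u udag : dual U) (v f : dual V).

(** A non-negative udag makes (udag, A udag) feasible, hence a competitor. *)
Lemma solution_energy_le J H A Al Au f alpha delta udag u v :
  (0 < alpha)%R -> dual_ge0 udag -> op_le Al A -> op_le A Au ->
  H (A udag) f <= delta%:E -> problem_solution J H Al Au alpha f u v ->
  alpha^-1%:E * H v f + J u <= (delta / alpha)%:E + J udag.
Proof.
move=> alpha_gt0 udag_ge0 AlA AAu Hdelta [_ /(_ udag (A udag)) opt].
apply: le_trans (opt _) _; first by split; [exact: AlA|exact: AAu].
by rewrite leeD2r// mulrC EFinM lee_wpmul2l// lee_fin invr_ge0 ltW.
Qed.

Lemma energy_J_le J H f alpha delta udag u v :
  (0 < alpha)%R -> (forall y g, 0 <= H y g) ->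
  alpha^-1%:E * H v f + J u <= (delta / alpha)%:E + J udag ->
  J u <= (delta / alpha)%:E + J udag.
Proof.
move=> alpha_gt0 H_ge0; apply: le_trans; rewrite leeDr// mule_ge0//.
by rewrite lee_fin invr_ge0 ltW.
Qed.

(** The Fenchel--Young inequality for H at v and q, divided by alpha, turns
    - H v f / alpha into the bracket with the conjugate minus the pairing of
    E^* mu with v - A udag; what is left of the linear part of the Bregman
    distance is the pairing of E^* mu with A u - v. *)
Lemma bregman_energy_le J H A Al Au f alpha delta udag u v
    (mu : dual (dual V) * dual (dual V)) :
  (0 < alpha)%R -> (forall x, 0 <= J x) -> (forall y g, 0 <= H y g) ->
  J udag \is a fin_num -> op_le Al A -> op_le A Au -> feasible Al Au u v ->
  alpha^-1%:E * H v f + J u <= (delta / alpha)%:E + J udag ->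
  bidual_ge0 mu.1 -> bidual_ge0 mu.2 ->
  let q := (alpha *: adjoint (opE (dual V)) (dual_pair mu))%R in
  bregman J (- adjoint (opB A) (dual_pair mu))%R u udag <=
    (delta / alpha)%:E
    + alpha^-1%:E * (convex_conjugate (H^~ f) q - (q (A udag))%:E)
    + ((`|mu.1| + `|mu.2|) * `|u| * `|Au - Al|)%:E.
Proof.
move=> alpha_gt0 J_ge0 H_ge0 Judag_fin AlA AAu uv energy mu1 mu2; cbv zeta.
set q := (alpha *: _)%R.
have := residual_pairing_le AlA AAu uv mu1 mu2.
have : (q v)%:E - H v f <= convex_conjugate (H^~ f) q.
  by apply: ereal_sup_ubound; exists v.
have pE : ((- adjoint (opB A) (dual_pair mu)) (u - udag) =
    - (mu.1 (A u - A udag) + mu.2 (A udag - A u)) :> R)%R.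
  by rewrite -[in RHS](opprB (A u)) -linearB.
have qE y : (q y = alpha * (mu.1 y + mu.2 (- y)) :> R)%R by [].
rewrite /bregman pE !qE.
have Ju_fin : J u \is a fin_num.
  rewrite ge0_fin_numE//; apply: le_lt_trans (energy_J_le _ _ energy) _ => //.
  by rewrite lte_add_pinfty ?ltry// ltey_eq Judag_fin.
move: energy; rewrite -(fineK Judag_fin) -(fineK Ju_fin).
have := H_ge0 v f; case: (H v f) => [h h0| |//]; last first.
  by rewrite gt0_muley ?lte_fin ?invr_gt0.
rewrite -!EFinM -!EFinD lee_fin => energy.
case: convex_conjugate => [c| |//]; last first.
  move=> _ _; rewrite addye// gt0_muley ?lte_fin ?invr_gt0// addey// addye//.
  exact: leey.
rewrite lee_fin -EFinB -EFinM -!EFinD lee_fin.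
have mu_sub (m : dual (dual V)) y z : (m (y - z) = (m y : R) - m z :> R)%R.
  exact: linearB.
have mu_opp (m : dual (dual V)) y : (m (- y) = - (m y : R) :> R)%R.
  exact: linearN.
rewrite !mu_sub !mu_opp => conj res.
set m1 : R := mu.1 (A udag); set m2 : R := mu.2 (A udag).
have : (alpha^-1 * (alpha * (mu.1 v - mu.2 v) - h - alpha * (m1 - m2)) <=
        alpha^-1 * (c - alpha * (m1 - m2)))%R.
  by rewrite ler_wpM2l ?invr_ge0 ?(ltW alpha_gt0)// lerB.
rewrite [in leLHS]mulrBr [in leLHS]mulrBr !mulKf ?lt0r_neq0//.
by move: energy res; rewrite -/m1 -/m2; lra.
Qed.

End Estimate.

Theorem theorem3p5 (R : realType) (U V : banachLatticeType R)
    (J : dual U -> \bar R) (H : dual V -> dual V -> \bar R)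
    (A : blin (dual U) (dual V)) (Al Au : nat -> blin (dual U) (dual V))
    (fbar : dual V) (f : nat -> dual V) (alpha delta eta : nat -> R)
    (udag : dual U) (mudag : dual (dual V) * dual (dual V))
    (u : nat -> dual U) (v : nat -> dual V)
    (A_regular : regular_op A)
    (alpha_gt0 : forall n, 0 < alpha n)
    (udag_min : J_minimising_solution J A fbar udag)
    (J_ge0 : forall x, (0 <= J x)%E)
    (J_proper : ereal_proper J)
    (J_convex : ereal_convex J)
    (J_lsc : lower_semicontinuous (J : weakstar U -> \bar R))
    (J_compact : forall c : R, [set x | (J x <= c%:E)%E] !=set0 ->
       seq_compact ([set x | (J x <= c%:E)%E] : set (weakstar U)))
    (H_ge0 : forall y g, (0 <= H y g)%E)
    (H_proper : ereal_proper (fun z : dual V * dual V => H z.1 z.2))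
    (H_convex : forall g, ereal_convex (H^~ g))
    (H_lsc : lower_semicontinuous
       (fun z : weakstar V * weakstar V => H z.1 z.2))
    (H_eq0 : forall y g, H y g = 0%E <-> y = g)
    (A_weakstar : continuous (A : weakstar U -> weakstar V))
    (Al_weakstar : forall n, continuous (Al n : weakstar U -> weakstar V))
    (Au_weakstar : forall n, continuous (Au n : weakstar U -> weakstar V))
    (mudag_ge0 : bidual_ge0 mudag.1 /\ bidual_ge0 mudag.2)
    (source : subdifferential J udag (- adjoint (opB A) (dual_pair mudag)))
    (A_bounds : forall n, op_le (Al n) A /\ op_le A (Au n))
    (eta_bound : forall n, `|Au n - Al n| <= eta n)
    (eta_cvg : eta n @[n --> \oo] --> (0 : R))
    (delta_bound : forall n, (H fbar (f n) <= (delta n)%:E)%E)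
    (delta_cvg : delta n @[n --> \oo] --> (0 : R))
    (alpha_cvg : alpha n @[n --> \oo] --> (0 : R))
    (delta_alpha_bound : exists K : R, forall n, delta n / alpha n <= K)
    (uv_solution : forall n,
       problem_solution J H (Al n) (Au n) (alpha n) (f n) (u n) (v n)) :
  exists C : R, forall n,
    let pdag := - adjoint (opB A) (dual_pair mudag) in
    let q := alpha n *: adjoint (opE (dual V)) (dual_pair mudag) in
    (bregman J pdag (u n) udag <=
       (delta n / alpha n)%:E
       + (alpha n)^-1%:E * (convex_conjugate (H^~ (f n)) q - (q fbar)%:E)
       + (C * eta n)%:E)%E.
Proof.
case: udag_min => Audag udag_ge0 _; subst fbar.
have Judag_fin : J udag \is a fin_num.
  rewrite ge0_fin_numE//; have [_ [x Jx]] := J_proper.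
  have := le_lt_trans (source x) Jx.
  case: (J udag) (J_ge0 udag) => [r _ _|_|//]; first exact: ltry.
  by rewrite addye// ltxx.
have energy n : ((alpha n)^-1%:E * H (v n) (f n) + J (u n) <=
    (delta n / alpha n)%:E + J udag)%E.
  have [AlA AAu] := A_bounds n.
  exact: solution_energy_le AlA AAu (delta_bound n) (uv_solution n).
have [K deltaK] := delta_alpha_bound.
pose c := K + fine (J udag).
have Ju n : (J (u n) <= c%:E)%E.
  apply: le_trans (energy_J_le _ H_ge0 (energy n)) _ => //.
  by rewrite -(fineK Judag_fin) -EFinD lee_fin lerD2r.
have [M JM] : exists M : R, forall x : dual U, (J x <= c%:E)%E -> `|x| <= M.
  apply: weakstar_seq_compact_bounded; apply: J_compact.
  by exists (u 0%N); exact: Ju.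
exists ((`|mudag.1| + `|mudag.2|) * M) => n; cbv zeta.
have [AlA AAu] := A_bounds n; have [mu1 mu2] := mudag_ge0.
apply: le_trans (bregman_energy_le (alpha_gt0 n) J_ge0 H_ge0
  Judag_fin AlA AAu (uv_solution n).1 (energy n) mu1 mu2) _.
rewrite leeD2l// lee_fin; apply: ler_pM => //.
by rewrite ler_wpM2l ?addr_ge0// JM.
Qed.
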